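(* Let $\mathcal N$ be a network of timed automata and let $\mathfrak a$ be a finite abstraction over global zones based on a time-abstract simulation $\preccurlyeq$. Let $G$ be any local sync graph of $\mathcal N$ based on $\mathfrak a$. Then a global state $q$ is reachable in $\mathcal N$ (i.e. $(q^{init},v^{init})\xrightarrow{u}(q,v)$ for some word $u$ and some global valuation $v$) if and only if some node $(q,\mathsf Z)$ with $\mathsf Z\neq\emptyset$ is reachable from the initial node in $G$.
   Context: Network: $\mathcal N=\langle A_1,\dots,A_k\rangle$, each $A_p=(Q_p,\Sigma_p,X_p,q^{init}_p,T_p)$ with finite state set $Q_p$, finite alphabet $\Sigma_p$, finite clock set $X_p$, initial state $q^{init}_p$, transitions $T_p\subseteq\Sigma_p\times Q_p\times\Phi(X_p)\times2^{X_p}\times Q_p$, where $\Phi(X_p)$ consists of finite conjunctions of atoms $x\sim c$ ($x\in X_p$, $c\in\mathbb N$, $\sim\in\{<,\le,=,\ge,>\}$). $Q_p$ pairwise disjoint, $X_p$ pairwise disjoint. $Q=\prod_pQ_p$, $q(p)$ the $p$-th component, $\Sigma=\bigcup\Sigma_p$, $X=\bigcup X_p$, $\mathrm{dom}(b)=\{p:b\in\Sigma_p\}$, $q^{init}=(q^{init}_1,\dots,q^{init}_k)$. Global semantics: offset variables $\tilde x$ for $x\in X$, $\tilde X_p=\{\tilde x:x\in X_p\}$, $\tilde X=\bigcup\tilde X_p$. A global valuation is $v:\tilde X\cup\{t\}\to\mathbb R_{\ge0}$ with $v(t)\ge v(\tilde x)$; clock $x$ has value $v(t)-v(\tilde x)$,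 and $v\models g$ is defined by these values. $v+\delta$ adds $\delta$ to $t$ only; $[R]v$ sets $\tilde x:=v(t)$ for $x\in R$. $v^{init}$ is identically $0$. Steps: $(q,v)\xrightarrow{\delta}(q,v+\delta)$; $(q,v)\xrightarrow{b}(q',v')$ if there are $b$-transitions $(b,q_p,g_p,R_p,q'_p)\in T_p$, $p\in\mathrm{dom}(b)$, with $q_p=q(p)$, $q'_p=q'(p)$ for $p\in\mathrm{dom}(b)$, $q'(p)=q(p)$ otherwise, $v\models g_p$, and $v'=[\bigcup_pR_p]v$. For $u=b_1\cdots b_n$, $(q_0,v_0)\xrightarrow{u}(q_n,v_n')$ means delays $\delta_0,\dots,\delta_n\ge0$ exist with $(q_0,v_0)\xrightarrow{\delta_0}\xrightarrow{b_1}\xrightarrow{\delta_1}\cdots\xrightarrow{b_n}\xrightarrow{\delta_n}(q_n,v'_n)$. Local semantics and zones: reference clocks $t_p$ per process; a local valuation is $\nu:\tilde X\cup\{t_1,\dots,t_k\}\to\mathbb R_{\ge0}$ with $\nu(t_p)\ge\nu(\tilde x)$ for $\tilde x\in\tilde X_p$; the value of $x\in X_p$ is $\nu(t_p)-\nu(\tilde x)$; $[R]\nu$ sets $\tilde x:=\nu(t_p)$ for $x\in R\cap X_p$; $\nu+_p\delta$ adds $\delta$ to $t_p$ only. $\nu$ is synchronized if all $\nu(t_p)$ are equal, and then $\mathrm{global}(\nu)$ is the global valuation with the same offsets and $t$ equal to the common value; $\mathrm{local}(v)$ sets all $t_p:=v(t)$. A global (resp. local) zone is a set of global (resp. local) valuations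 defined by finitely many constraints $y_1-y_2\triangleleft c$, $\triangleleft\in\{<,\le\}$, $c\in\mathbb Z$, over $\tilde X\cup\{t\}$ (resp. $\tilde X\cup\{t_1,\dots,t_k\}$). $\operatorname{local-elapse}(\mathsf Z)=\{\nu+_1\delta_1\cdots+_k\delta_k:\nu\in\mathsf Z,\delta_i\ge0\}$; $\mathsf Z$ is time-elapsed if $\mathsf Z=\operatorname{local-elapse}(\mathsf Z)$. $\operatorname{sync}(\mathsf Z)$ is the set of synchronized valuations in $\mathsf Z$, and $\mathrm{global}(\operatorname{sync}(\mathsf Z))=\{\mathrm{global}(\nu):\nu\in\operatorname{sync}(\mathsf Z)\}$ (a global zone). Local zone graph $\mathrm{LZG}(\mathcal N)$: nodes $(q,\mathsf Z)$ with $\mathsf Z$ a time-elapsed local zone; initial node $(q^{init},\operatorname{local-elapse}(\{\mathrm{local}(v^{init})\}))$; transitions $(q,\mathsf Z)\Rightarrow_b(q',\mathsf Z')$ for each choice of $b$-transitions $(b,q_p,g_p,R_p,q'_p)\in T_p$, $p\in\mathrm{dom}(b)$, with $q(p)=q_p$, $q'(p)=q'_p$ for $p\in\mathrm{dom}(b)$, $q'(p)=q(p)$ otherwise, where $\mathsf Z'=\operatorname{local-elapse}([R](\mathsf Z\cap\mathsf Z_g\cap\mathsf Z_{sync}))$, $R=\bigcup_pR_p$, $\mathsf Z_g=\{\nu:\nu\models g_p\ \forall p\in\mathrm{dom}(b)\}$, $\mathsf Z_{sync}=\{\nu:\nu(t_{p_1})=\nu(t_{p_2})\ \forall p_1,p_2\in\mathrm{dom}(b)\}$.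 Simulation and abstraction: a time-abstract simulation is a relation $\preccurlyeq$ on global valuations such that whenever $v_1\preccurlyeq v_2$, for every state $q$ and every $(q,v_1)\xrightarrow{\delta_1}\xrightarrow{b}(q',v_1')$ there is $\delta_2\ge0$ with $(q,v_2)\xrightarrow{\delta_2}\xrightarrow{b}(q',v_2')$ and $v_1'\preccurlyeq v_2'$. The abstraction based on $\preccurlyeq$ is $\mathfrak a(W)=\{v:\exists v'\in W,\ v\preccurlyeq v'\}$; it is finite if its range (on global zones) is finite. For global zones, $Z\sqsubseteq^{\mathfrak a}Z'$ iff $Z\subseteq\mathfrak a(Z')$. For nodes $s=(q,\mathsf Z)$, $s'=(q',\mathsf Z')$ of $\mathrm{LZG}(\mathcal N)$, $s\sqsubseteq^{\mathfrak a}_{sync}s'$ iff $q=q'$ and $\mathrm{global}(\operatorname{sync}(\mathsf Z))\sqsubseteq^{\mathfrak a}\mathrm{global}(\operatorname{sync}(\mathsf Z'))$. Local sync graph of $\mathcal N$ based on $\mathfrak a$: a subgraph $G$ of $\mathrm{LZG}(\mathcal N)$ which is a tree and satisfies: (C0) every node is labeled covered or uncovered; (C1) the initial node of $\mathrm{LZG}(\mathcal N)$ is in $G$ and uncovered; (C2) every node is reachable from the initial node; (C3) for every uncovered node $s$, every transition $s\Rightarrow_a s'$ of $\mathrm{LZG}(\mathcal N)$ is present in $G$; (C4) for every covered node $s$ there is an uncovered node $s'$ of $G$ with $s\sqsubseteq^{\mathfrak a}_{sync}s'$, and covered nodes have no successors.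
   Formalization: Zones, local and global, may also compare a variable with the constant 0 (finiteness of the abstraction is over these zones); with only constraints between two variables the initial node would not be a zone. The tree G may repeat nodes of the local zone graph. *)

(* Defs.v *)
From HB Require Import structures.
From mathcomp Require Import all_boot all_order all_algebra.
From mathcomp Require Import interval_inference.
From mathcomp Require Import boolp classical_sets cardinality reals.

Set Implicit Arguments.
Unset Strict Implicit.
Unset Printing Implicit Defensive.

Import Order.TTheory GRing.Theory Num.Theory.

Local Open Scope classical_set_scope.
Local Open Scope ring_scope.

#[local] Obligation Tactic := idtac.

Inductive cmp := CLt | CLe | CEq | CGe | CGt.

Definition cmp_sat (R : realType) (o : cmp) (a b : R) : bool :=
  match o with
  | CLt => a < b
  | CLe => a <= b
  | CEq => a == b
  | CGe => a >= b
  | CGt => a > b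
  end.

Record atom (X : Type) := Atom { atom_clock : X; atom_cmp : cmp; atom_cst : nat }.

(* A list of atoms stands for their conjunction. *)
Definition guard (X : Type) := seq (atom X).

Definition guard_sat (R : realType) (X : Type) (val : X -> R) (g : guard X) : bool :=
  all (fun a => cmp_sat (atom_cmp a) (val (atom_clock a)) (atom_cst a)%:R) g.

Record transition (A : Type) (Q X : finType) := Transition {
  tr_label : A;
  tr_src : Q;
  tr_guard : guard X;
  tr_resets : {set X};
  tr_dst : Q }.

(* All alphabets are subsets of one ambient finite type A, since letters are
   shared between processes; only letters in some [alphabet] are ever used. *)
Record automaton (A : finType) := Automaton {
  state : finType;
  alphabet : {set A};
  clock : finType;
  q_init : state;
  trans : set (transition A state clock);
  trans_label : forall e, trans e -> tr_label e \in alphabet }.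

Arguments trans {A} a e.

(* A network with at least one process. States and clocks of different
   processes live in different types, hence are disjoint. *)
Definition network (A : finType) (k : nat) := 'I_k.+1 -> automaton A.

Section Network.
Context {A : finType} {k : nat} (N : network A k).

Definition gstate := forall p, state (N p).

Definition gstate_init : gstate := fun p => q_init (N p).

Definition dom (b : A) : {set 'I_k.+1} := [set p | b \in alphabet (N p)]%SET.

(* A choice of one transition per process; values outside dom(b) are ignored. *)
Definition trchoice := forall p, transition A (state (N p)) (clock (N p)).

Definition is_choice (b : A) (q q' : gstate) (e : trchoice) : Prop :=
  dom b != finset.set0 /\
  forall p, if p \in dom b
            then [/\ trans (N p) (e p), tr_label (e p) = b,
                     tr_src (e p) = q p & tr_dst (e p) = q' p]
            else q' p = q p.

Definition clockset := forall p, {set clock (N p)}.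

Definition resets (b : A) (e : trchoice) : clockset :=
  fun p => if p \in dom b then tr_resets (e p) else finset.set0.

End Network.

Section Semantics.
Context (R : realType) {A : finType} {k : nat} (N : network A k).

(* [goff v x] is the value of the offset variable of the clock x. *)
Record gval := GVal {
  goff : forall p, clock (N p) -> R;
  gtime : R;
  goff_ge0 : forall p (x : clock (N p)), 0 <= goff x;
  gtime_ge0 : 0 <= gtime;
  goff_le : forall p (x : clock (N p)), goff x <= gtime }.

Program Definition gval_init : gval := @GVal (fun _ _ => 0) 0 _ _ _.
Next Obligation. by []. Qed.
Next Obligation. by []. Qed.
Next Obligation. by []. Qed.

Program Definition gdelay (v : gval) (d : {nonneg R}) : gval :=
  @GVal (@goff v) (gtime v + d%:num) _ _ _.
Next Obligation. by move=> v d p x; exact: goff_ge0. Qed.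
Next Obligation. by move=> v d; rewrite addr_ge0 // gtime_ge0. Qed.
Next Obligation. by move=> v d p x; rewrite ler_wpDr // goff_le. Qed.

Program Definition greset (r : clockset N) (v : gval) : gval :=
  @GVal (fun p x => if x \in r p then gtime v else goff v x) (gtime v) _ _ _.
Next Obligation.
by move=> r v p x /=; case: ifP => _; [exact: gtime_ge0|exact: goff_ge0].
Qed.
Next Obligation. by move=> r v; exact: gtime_ge0. Qed.
Next Obligation. by move=> r v p x /=; case: ifP => // _; exact: goff_le. Qed.

Definition gsat (v : gval) p (g : guard (clock (N p))) : bool :=
  guard_sat (fun x => gtime v - goff v x) g.

Definition gaction (b : A) (s s' : gstate N * gval) : Prop :=
  exists e : trchoice N,
    [/\ is_choice b s.1 s'.1 e,
        forall p, p \in dom N b -> gsat s.2 (tr_guard (e p)) &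
        s'.2 = greset (resets b e) s.2].

Inductive grun : gstate N * gval -> seq A -> gstate N * gval -> Prop :=
| grun_nil q v d : grun (q, v) [::] (q, gdelay v d)
| grun_cons q v d b s1 u s2 :
    gaction b (q, gdelay v d) s1 -> grun s1 u s2 -> grun (q, v) (b :: u) s2.

Definition greachable (q : gstate N) : Prop :=
  exists (u : seq A) (v : gval), grun (gstate_init N, gval_init) u (q, v).

Record lval := LVal {
  loff : forall p, clock (N p) -> R;
  ltime : 'I_k.+1 -> R;
  loff_ge0 : forall p (x : clock (N p)), 0 <= loff x;
  ltime_ge0 : forall p, 0 <= ltime p;
  loff_le : forall p (x : clock (N p)), loff x <= ltime p }.

(* nu +_1 d_1 ... +_k d_k *)
Program Definition ldelay (nu : lval) (d : 'I_k.+1 -> {nonneg R}) : lval :=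
  @LVal (@loff nu) (fun p => ltime nu p + (d p)%:num) _ _ _.
Next Obligation. by move=> nu d p x; exact: loff_ge0. Qed.
Next Obligation. by move=> nu d p; rewrite addr_ge0 // ltime_ge0. Qed.
Next Obligation. by move=> nu d p x; rewrite ler_wpDr // loff_le. Qed.

Program Definition lreset (r : clockset N) (nu : lval) : lval :=
  @LVal (fun p x => if x \in r p then ltime nu p else loff nu x) (ltime nu) _ _ _.
Next Obligation.
by move=> r nu p x /=; case: ifP => _; [exact: ltime_ge0|exact: loff_ge0].
Qed.
Next Obligation. by move=> r nu p; exact: ltime_ge0. Qed.
Next Obligation. by move=> r nu p x /=; case: ifP => // _; exact: loff_le. Qed.

Definition lsat (nu : lval) p (g : guard (clock (N p))) : bool :=
  guard_sat (fun x => ltime nu p - loff nu x) g.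

Definition synchronized (nu : lval) : Prop :=
  forall p1 p2, ltime nu p1 = ltime nu p2.

Program Definition global (nu : lval) (h : synchronized nu) : gval :=
  @GVal (@loff nu) (ltime nu ord0) _ _ _.
Next Obligation. by move=> nu h p x; exact: loff_ge0. Qed.
Next Obligation. by move=> nu h; exact: ltime_ge0. Qed.
Next Obligation. by move=> nu h p x; rewrite (h ord0 p) loff_le. Qed.

Program Definition local (v : gval) : lval :=
  @LVal (@goff v) (fun=> gtime v) _ _ _.
Next Obligation. by move=> v p x; exact: goff_ge0. Qed.
Next Obligation. by move=> v p; exact: gtime_ge0. Qed.
Next Obligation. by move=> v p x; exact: goff_le. Qed.

(* y1 - y2 < c or y1 - y2 <= c with c an integer; [None] is the constant 0.
   Without the constant, sets of valuations defined by constraints are closed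
   under increasing all variables by the same amount, and the initial node of
   the local zone graph, where all offsets are 0, would not be a zone. *)
Record constr (V : Type) := Constr {
  c_left : option V;
  c_right : option V;
  c_strict : bool;
  c_bound : int }.

Definition constr_sat (V : Type) (val : V -> R) (c : constr V) : bool :=
  let y1 := oapp val 0 (c_left c) in
  let y2 := oapp val 0 (c_right c) in
  if c_strict c then y1 - y2 < (c_bound c)%:~R else y1 - y2 <= (c_bound c)%:~R.

Inductive gvar := GOff p of clock (N p) | GTime.
Inductive lvar := LOff p of clock (N p) | LTime of 'I_k.+1.

Definition gvar_val (v : gval) (y : gvar) : R :=
  match y with GOff _ x => goff v x | GTime => gtime v end.

Definition lvar_val (nu : lval) (y : lvar) : R :=
  match y with LOff _ x => loff nu x | LTime p => ltime nu p end.

Definition gzone : set (set gval) :=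
  [set Z | exists cs : seq (constr gvar),
           Z = [set v | all (constr_sat (gvar_val v)) cs]].

Definition lzone : set (set lval) :=
  [set Z | exists cs : seq (constr lvar),
           Z = [set nu | all (constr_sat (lvar_val nu)) cs]].

Definition local_elapse (Z : set lval) : set lval :=
  [set nu' | exists nu d, Z nu /\ nu' = ldelay nu d].

Definition time_elapsed (Z : set lval) : Prop := Z = local_elapse Z.

(* global(sync(Z)) *)
Definition global_sync (Z : set lval) : set gval :=
  [set v | exists (nu : lval) (h : synchronized nu), Z nu /\ v = global h].

Definition lnode : Type := gstate N * set lval.

Definition lzg_node (s : lnode) : Prop := lzone s.2 /\ time_elapsed s.2.

Definition lzg_init : lnode :=
  (gstate_init N, local_elapse [set local gval_init]).

Definition Z_guard (b : A) (e : trchoice N) : set lval :=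
  [set nu | forall p, p \in dom N b -> lsat nu (tr_guard (e p))].

Definition Z_sync (b : A) : set lval :=
  [set nu | forall p1 p2, p1 \in dom N b -> p2 \in dom N b ->
            ltime nu p1 = ltime nu p2].

Definition lzg_trans (s : lnode) (b : A) (s' : lnode) : Prop :=
  exists e : trchoice N,
    is_choice b s.1 s'.1 e /\
    s'.2 = local_elapse
             (lreset (resets b e) @` (s.2 `&` Z_guard b e `&` Z_sync b)).

Definition time_abstract_simulation (le : gval -> gval -> Prop) : Prop :=
  forall v1 v2, le v1 v2 ->
  forall (q q' : gstate N) (d1 : {nonneg R}) (b : A) (v1' : gval),
    gaction b (q, gdelay v1 d1) (q', v1') ->
    exists (d2 : {nonneg R}) (v2' : gval),
      gaction b (q, gdelay v2 d2) (q', v2') /\ le v1' v2'.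

Definition abstraction (le : gval -> gval -> Prop) (W : set gval) : set gval :=
  [set v | exists v', W v' /\ le v v'].

Definition finite_abstraction (a : set gval -> set gval) : Prop :=
  finite_set (a @` gzone).

Definition subsumed (a : set gval -> set gval) (s s' : lnode) : Prop :=
  s.1 = s'.1 /\ global_sync s.2 `<=` a (global_sync s'.2).

(* A graph over the local zone graph. A tree may contain several vertices
   standing for the same node of the local zone graph (e.g. the end nodes of
   two interleavings of independent actions), so vertices carry nodes as
   labels; a plain subgraph is the case where [vnode] is injective. *)
Record lgraph := LGraph {
  vertex : Type;
  vroot : vertex;
  vnode : vertex -> lnode;
  edge : vertex -> A -> vertex -> Prop;
  covered : vertex -> bool }.

Inductive reach (G : lgraph) : vertex G -> vertex G -> Prop :=
| reach_refl x : reach x x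
| reach_step x y z b : reach x y -> edge y b z -> reach x z.

Definition lzg_subgraph (G : lgraph) : Prop :=
  (forall x : vertex G, lzg_node (vnode x)) /\
  (forall (x : vertex G) b y, edge x b y -> lzg_trans (vnode x) b (vnode y)).

Definition is_tree (G : lgraph) : Prop :=
  [/\ forall (x : vertex G) b, ~ edge x b (vroot G),
      forall (x1 x2 : vertex G) b1 b2 y,
        edge x1 b1 y -> edge x2 b2 y -> x1 = x2 /\ b1 = b2 &
      forall x : vertex G, reach (vroot G) x].

(* (C0) is the totality of [covered]. *)
Record local_sync_graph (a : set gval -> set gval) (G : lgraph) : Prop := {
  lsg_subgraph : lzg_subgraph G;
  lsg_tree : is_tree G;
  lsg_C1 : vnode (vroot G) = lzg_init /\ ~~ covered (vroot G);
  lsg_C2 : forall x : vertex G, reach (vroot G) x;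
  lsg_C3 : forall x : vertex G, ~~ covered x ->
    forall b s', lzg_trans (vnode x) b s' ->
    exists y : vertex G, edge x b y /\ vnode y = s';
  lsg_C4 : forall x : vertex G, covered x ->
    (exists y : vertex G, ~~ covered y /\ subsumed a (vnode x) (vnode y)) /\
    (forall b y, ~ edge x b y) }.

End Semantics.

(* Main.v *)
(* Completeness: along a global run, the current valuation stays in
   global(sync(Z)) of an uncovered vertex; when a step leads to a covered
   vertex, the rest of the run is transferred by the simulation to a valuation
   of the uncovered vertex covering it.

   Soundness: a local run executes events whose times are only ordered along
   each process. Such an event can be inserted into a time-ordered global run:
   every later event of the run involves none of the processes of the inserted
   one, hence commutes with it. *)

Require Import Defs.
From HB Require Import structures.
From mathcomp Require Import all_boot all_order all_algebra.
From mathcomp Require Import interval_inference.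
From mathcomp Require Import boolp classical_sets cardinality reals.

Set Implicit Arguments.
Unset Strict Implicit.
Unset Printing Implicit Defensive.

Import Order.TTheory GRing.Theory Num.Theory.

Local Open Scope classical_set_scope.

Section LocalSyncGraph.
Local Open Scope ring_scope.
Context (R : realType) (A : finType) (k : nat) (N : network A k).

Implicit Types (q : gstate N) (e : trchoice N) (v : gval R N) (nu : lval R N).

(** * Global valuations and runs *)

Lemma gval_eq v v' : (forall p (x : clock (N p)), goff v x = goff v' x) ->
  gtime v = gtime v' -> v = v'.
Proof.
case: v v' => [o t ? ? ?] [o' t' ? ? ?] /= eo et; subst t'.
have eoo : o = o' by apply: functional_extensionality_dep => p; apply: funext.
by subst o'; congr GVal; exact: Prop_irrelevance.
Qed.

Lemma gdelayD v (d d' d'' : {nonneg R}) : d''%:num = d%:num + d'%:num ->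
  gdelay (gdelay v d) d' = gdelay v d''.
Proof. by move=> dE; apply: gval_eq => //=; rewrite dE addrA. Qed.

Lemma gdelay0 v : gdelay v 0%:nng = v.
Proof. by apply: gval_eq => //=; rewrite addr0. Qed.

Lemma grun_rcons (s s' s1 : gstate N * gval R N) u b (d : {nonneg R}) :
  grun s u s' -> gaction b (s'.1, gdelay s'.2 d) s1 -> grun s (rcons u b) s1.
Proof.
elim=> {s u s'} [q v d0|q v d0 b0 s2 u s3 act _ IH] /= act1; last first.
  exact: grun_cons act (IH act1).
(* The trailing delay [d0] of the run and [d] merge into the one delay before [b]. *)
apply: (@grun_cons _ _ _ _ _ _ (d0%:num + d%:num)%:nng _ s1).
  by rewrite -(gdelayD v (d := d0) (d' := d)).
by case: s1 {act1} => q1 v1; rewrite -{2}(gdelay0 v1); exact: grun_nil.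
Qed.

(** A simulation matches only delays followed by an action, so the trailing delay is copied and the
    final valuations are left unrelated. *)
Lemma grun_sim (le : gval R N -> gval R N -> Prop) s u s' v :
  time_abstract_simulation le -> grun s u s' -> le s.2 v ->
  exists v', grun (s.1, v) u (s'.1, v').
Proof.
move=> hsim run; elim: run v => {s u s'} [q v0 d|q v0 d b [q1 v1] u s2 act _ IH] v /= lev.
  by exists (gdelay v d); exact: grun_nil.
have [d2 [v1' [act' le1]]] := hsim _ _ lev _ _ _ _ _ act.
have [v' run'] := IH _ le1.
by exists v'; exact: grun_cons act' run'.
Qed.

(** * Time-ordered runs and insertion of events *)

Section Events.
Implicit Types (off : forall p, clock (N p) -> R) (last : 'I_k.+1 -> R) (t : R).

Definition event_enabled b e q q' off t : Prop :=
  is_choice b q q' e /\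
  forall p, p \in dom N b -> guard_sat (fun x => t - off p x) (tr_guard (e p)).

Definition off_after b e t off : forall p, clock (N p) -> R :=
  fun p x => if x \in resets b e p then t else off p x.

Definition last_after b t last : 'I_k.+1 -> R :=
  fun p => if p \in dom N b then t else last p.

(* [ordered_run q off last t]: a sequence of events executed at nondecreasing
   times leads to state q and offsets off; the time of the last event is
   [last p] for process p, and t overall. *)
Inductive ordered_run :
    gstate N -> (forall p, clock (N p) -> R) -> ('I_k.+1 -> R) -> R -> Prop :=
| ordered_run_init : ordered_run (gstate_init N) (fun _ _ => 0) (fun _ => 0) 0
| ordered_run_step b e q q' off last t t' :
    ordered_run q off last t -> t <= t' -> event_enabled b e q q' off t' ->
    ordered_run q' (off_after b e t' off) (last_after b t' last) t'.

Lemma ordered_run_grun q off last t : ordered_run q off last t ->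
  exists u v, [/\ grun (gstate_init N, gval_init R N) u (q, v),
                  @goff _ _ _ _ v = off & gtime v = t].
Proof.
elim=> {q off last t} [|b e q q' off last t t' _ [u [v [run <- <-]]] tt' [ch gd]].
  exists [::], (gdelay (gval_init R N) 0%:nng).
  by split; [exact: grun_nil | by [] | rewrite /= addr0].
have [d dE] : exists d : {nonneg R}, gtime v + d%:num = t'.
  have d0 : 0 <= t' - gtime v by rewrite subr_ge0.
  by exists (NngNum d0); rewrite /= addrC subrK.
exists (rcons u b), (greset (resets b e) (gdelay v d)); split => //=.
- apply: (grun_rcons (d := d) run); exists e; split=> //= p pb.
  have := gd p pb; rewrite -dE; exact.
- apply: functional_extensionality_dep => p; apply: funext => x.
  by rewrite /off_after -dE.
Qed.

(** Induction on the run: if its last event is later than [t'], the new event is inserted into the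
    prefix and that last event is replayed after it. *)
Lemma ordered_run_insert q off last t b e q' t' :
  ordered_run q off last t -> (forall p, p \in dom N b -> last p <= t') ->
  0 <= t' -> event_enabled b e q q' off t' ->
  ordered_run q' (off_after b e t' off) (last_after b t' last) (Num.max t t').
Proof.
move=> run; elim: run q' => {q off last t} [|b2 e2 q0 q off last t0 t run IH t0t [ch2 gd2]].
  move=> q' _ t'0 en; rewrite max_r //.
  exact: ordered_run_step ordered_run_init t'0 en.
move=> q' hlast t'0 [ch gd].
have [tt'|t't] := leP t t'.
  exact: ordered_run_step (ordered_run_step run t0t (conj ch2 gd2)) tt' (conj ch gd).
(* A shared process would have its last event at [t], which exceeds [t']. *)
have disj p : p \in dom N b -> p \in dom N b2 = false.
  move=> pb; apply/negP => pb2; have := hlast p pb.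
  by rewrite /last_after pb2 leNgt t't.
have disj2 p : p \in dom N b2 -> p \in dom N b = false.
  by move=> pb2; apply/negP => /disj; rewrite pb2.
have offE p : p \in dom N b -> off_after b2 e2 t off (p := p) = off p.
  move=> pb; apply: funext => x.
  by rewrite /off_after /resets (disj _ pb) finset.in_set0.
(* The state between the swapped events: [b] has moved its processes, [b2] has not yet moved its
   own. *)
pose q0' : gstate N := fun p => if p \in dom N b then q' p else q0 p.
have en0 : event_enabled b e q0 q0' off t'.
  split; last by move=> p pb; have := gd p pb; rewrite (offE _ pb).
  case: ch ch2 => [b0 ch] [_ ch2]; split=> // p; rewrite /q0'.
  have := ch2 p; have := ch p; have := @disj p.
  by case: (p \in dom N b) => // /(_ isT) -> + <-.
have hlast0 p : p \in dom N b -> last p <= t'.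
  by move=> pb; have := hlast p pb; rewrite /last_after (disj _ pb).
have run0 := IH _ hlast0 t'0 en0.
have en2 : event_enabled b2 e2 q0' q' (off_after b e t' off) t.
  split.
    case: ch ch2 => [_ ch] [b20 ch2]; split=> // p; rewrite /q0'.
    have := ch p; have := ch2 p; have := @disj2 p.
    case: (p \in dom N b2) => [/(_ isT) -> [? ? ? ?] -> //|_].
    by case: (p \in dom N b) => // -> ->.
  move=> p pb2; have := gd2 p pb2; congr (is_true (guard_sat _ _)).
  by apply: funext => x; rewrite /off_after /resets (disj2 _ pb2) finset.in_set0.
have mt : Num.max t0 t' <= t by rewrite ge_max t0t ltW.
have := ordered_run_step run0 mt en2.
(* The two updates commute, as they touch disjoint sets of processes. *)
congr ordered_run.
  apply: functional_extensionality_dep => p; apply: funext => x.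
  rewrite /off_after /resets; have := @disj p.
  by case: (p \in dom N b) => [/(_ isT) ->|_]; rewrite finset.in_set0.
apply: funext => p; rewrite /last_after; have := @disj p.
by case: (p \in dom N b) => [/(_ isT) ->|].
Qed.

End Events.

(** * Soundness of the local zone graph *)

(** The soundness invariant. A reference clock is compared only with the last event of its own
    process: it may lag behind [t]. *)
Definition realizable q nu : Prop := exists last t,
  ordered_run q (@loff _ _ _ _ nu) last t /\ forall p, last p <= ltime nu p.

Lemma realizable_delay q nu d : realizable q nu -> realizable q (ldelay nu d).
Proof.
move=> [last [t [run hl]]]; exists last, t; split=> // p /=.
by rewrite ler_wpDr.
Qed.

Lemma realizable_step q q' nu b e : realizable q nu -> is_choice b q q' e ->
  Z_guard b e nu -> Z_sync b nu -> realizable q' (lreset (resets b e) nu).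
Proof.
move=> [last [t [run hl]]] ch gd sy.
(* The common reference time of the processes of [b], read at [p0], is where the event is
   inserted. *)
have [p0 p0b] : exists p0, p0 \in dom N b by apply/set0Pn; case: ch.
have tE p : p \in dom N b -> ltime nu p = ltime nu p0 by move=> pb; exact: sy.
exists (last_after b (ltime nu p0) last), (Num.max t (ltime nu p0)); split; last first.
  by move=> p /=; rewrite /last_after; case: ifP => // pb; rewrite tE.
suff -> : @loff _ _ _ _ (lreset (resets b e) nu) =
    off_after b e (ltime nu p0) (@loff _ _ _ _ nu).
  apply: ordered_run_insert run _ _ _; last 1 first.
  - by split=> // p pb; have := gd p pb; rewrite /lsat (tE _ pb).
  - by move=> p pb; rewrite -(tE _ pb).
  - exact: ltime_ge0.
apply: functional_extensionality_dep => p; apply: funext => x /=.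
rewrite /off_after /resets; case: ifP => //; case: ifP => [pb _|]; first exact: tE.
by rewrite finset.in_set0.
Qed.

Lemma lzg_init_realizable nu : (lzg_init R N).2 nu -> realizable (gstate_init N) nu.
Proof.
move=> [_ [d [-> ->]]]; apply: realizable_delay; exists (fun=> 0), 0.
by split=> //; exact: ordered_run_init.
Qed.

Lemma lzg_trans_realizable (s s' : lnode R N) b : lzg_trans s b s' ->
  (forall nu, s.2 nu -> realizable s.1 nu) ->
  forall nu, s'.2 nu -> realizable s'.1 nu.
Proof.
move=> [e [ch ->]] IH _ [_ [d [[nu [[Znu gd] sy] <-] ->]]].
exact: realizable_delay (realizable_step (IH _ Znu) ch gd sy).
Qed.

Lemma reach_realizable (G : lgraph R N) (x y : vertex G) :
  lzg_subgraph G -> vnode x = lzg_init R N -> reach x y ->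
  forall nu, (vnode y).2 nu -> realizable (vnode y).1 nu.
Proof.
move=> [_ sub] + r; elim: r => {x y} [x ->|x y z b _ IH /sub tr x0].
  exact: lzg_init_realizable.
exact: lzg_trans_realizable tr (IH x0).
Qed.

Lemma realizable_greachable q nu : realizable q nu -> greachable R q.
Proof.
move=> [last [t [run _]]].
by have [u [v [gr _ _]]] := ordered_run_grun run; exists u, v.
Qed.

(** * Completeness of local sync graphs *)

Lemma gaction_lzg_trans q (Z : set (lval R N)) v d b s1 :
  time_elapsed Z -> global_sync Z v -> gaction b (q, gdelay v d) s1 ->
  exists Z1, lzg_trans (q, Z) b (s1.1, Z1) /\ global_sync Z1 s1.2.
Proof.
move=> elZ [nu [h [Znu vE]]] [e [/= ch gd s1E]].
(* The same delay for every process preserves synchronization, and [Z] is closed under it. *)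
pose nu' := ldelay nu (fun=> d).
have Znu' : Z nu' by rewrite elZ; exists nu, (fun=> d).
eexists; split; first by exists e; split; first exact: ch.
pose nu1 := ldelay (lreset (resets b e) nu') (fun=> NngNum (lexx (0 : R))).
have h1 : synchronized nu1 by move=> p1 p2 /=; rewrite (h p1 p2).
exists nu1, h1; split.
  exists (lreset (resets b e) nu'), (fun=> NngNum (lexx (0 : R))); split=> //.
  exists nu' => //; split; first split=> // p pb; last first.
    by move=> p1 p2 _ _ /=; rewrite (h p1 p2).
  by have := gd p pb; rewrite vE /gsat /lsat /= (h ord0 p).
rewrite s1E vE; apply: gval_eq => [p x|] /=; last by rewrite addr0.
by case: ifP => // _; rewrite (h ord0 p).
Qed.

(** Induction on the word, not on the run: passing to a covering vertex replaces the remaining run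
    by another one over the same word. *)
Lemma grun_local_sync_graph (le : gval R N -> gval R N -> Prop) (G : lgraph R N) :
  time_abstract_simulation le -> local_sync_graph (abstraction le) G ->
  forall u (x : vertex G) q v q' v', ~~ covered x -> (vnode x).1 = q ->
  global_sync (vnode x).2 v -> grun (q, v) u (q', v') ->
  exists y : vertex G, (vnode y).1 = q' /\ (vnode y).2 !=set0.
Proof.
move=> hsim hG; elim=> [|b u IH] x q v q' v' ux xq Zv run.
  by inversion run; subst; exists x; split=> //; case: Zv => nu [_ [? _]]; exists nu.
inversion run as [|? ? d ? s1 ? ? act run1]; subst.
have elx : time_elapsed (vnode x).2 by have [/(_ x) []] := lsg_subgraph hG.
have [Z1 [tr Z1v]] := gaction_lzg_trans elx Zv act.
rewrite -surjective_pairing in tr.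
have [y [_ yE]] := lsg_C3 hG ux tr.
case: s1 act run1 Z1v yE {tr} => q1 v1 act run1 /= Z1v yE.
have [cy|uy] := boolP (covered y); last by apply: (IH y q1 v1) run1; rewrite ?yE.
have [[z [uz [zq sub]]] _] := lsg_C4 hG cy.
rewrite yE /= in zq sub; have [v2 [Zv2 le12]] := sub _ Z1v.
have [v2' run2] := grun_sim hsim run1 le12.
exact: IH z q1 v2 q' v2' uz (esym zq) Zv2 run2.
Qed.

End LocalSyncGraph.

Theorem theorem26 (R : realType) (A : finType) (k : nat) (N : network A k)
    (le : gval R N -> gval R N -> Prop)
    (hsim : time_abstract_simulation le)
    (hfin : finite_abstraction (abstraction le))
    (G : lgraph R N) (hG : local_sync_graph (abstraction le) G)
    (q : gstate N) :
  greachable R q <->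
  exists (x : vertex G) (Z : set (lval R N)),
    [/\ reach (vroot G) x, vnode x = (q, Z) & Z !=set0].
Proof.
have [rootE uroot] := lsg_C1 hG; split.
  move=> [u [v run]].
  have Zinit : global_sync (vnode (vroot G)).2 (gval_init R N).
    (* Zero delays show that the initial valuation lies in its own local elapse. *)
    pose nu := ldelay (local (gval_init R N)) (fun=> NngNum (lexx (0 : R)%R)).
    have h : synchronized nu by [].
    exists nu, h; rewrite rootE; split.
      by exists (local (gval_init R N)), (fun=> NngNum (lexx (0 : R)%R)).
    by apply: gval_eq => //=; rewrite addr0.
  have rootq : (vnode (vroot G)).1 = gstate_init N by rewrite rootE.
  have [y [yq yZ]] := grun_local_sync_graph hsim hG uroot rootq Zinit run.
  exists y, (vnode y).2; split=> //; first exact: (lsg_C2 hG).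
  by rewrite -yq -surjective_pairing.
move=> [x [Z [rx xE [nu Znu]]]].
have := reach_realizable (lsg_subgraph hG) rootE rx.
by rewrite xE => /(_ nu Znu); exact: realizable_greachable.
Qed.
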